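(* Let $G$ be a simple connected graph with $n$ nodes and $m$ edges, let $q\ge1$ and $k\ge0$ be integers, and let $\bar{\mathcal K}_{q,k}$ and $\hat{\mathcal K}_{q,k}$ denote the additive and multiplicative degree-Kirchhoff indices of the iterated $q$-triangulation graph $R_{q,k}(G)$ (so $\bar{\mathcal K}_{q,0}=\bar{\mathcal K}(G)$ and $\hat{\mathcal K}_{q,0}=\hat{\mathcal K}(G)$). Then $$\begin{aligned}\bar{\mathcal K}_{q,k}=&\Big(\frac{2(2q+1)}{q+2}\Big)^k\bar{\mathcal K}_{q,0}\\ &+\Big[\Big(\frac{2(2q+1)^2}{q+2}\Big)^k-\Big(\frac{2(2q+1)}{q+2}\Big)^k\Big]\bigg(\frac{\hat{\mathcal K}_{q,0}}{2}-\frac{2(q+2)m^2+(2q+1)mn-m(q-1)}{3(2q+1)}\bigg)\\ &+\Big[(2q+1)^{2k}-\Big(\frac{2(2q+1)}{q+2}\Big)^k\Big]\frac{m^2(2q+3)(6q+11)}{4(2q+1)(2q+5)}\\ &+\Big[\Big(\frac{2(2q+1)}{q+2}\Big)^k-(2q+1)^k\Big]\Big(\frac{m}{2(2q+1)}+\frac{(q+2)m(m-2n+1)}{3(2q+1)}\Big)\\ &-\Big[\Big(\frac{2(2q+1)}{q+2}\Big)^k-1\Big]\frac{(m-2n)(m-2n+2)}{12}.\end{aligned}$$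
   Context: For a positive integer $q$, the $q$-triangulation graph $R_q(G)$ is obtained from $G$ by keeping all nodes and edges of $G$ and adding, for each edge $uv$ of $G$, $q$ disjoint paths of length $2$: $ux_1v,\dots,ux_qv$, where $x_1,\dots,x_q$ are new nodes. The iterated $q$-triangulation graphs are $R_{q,0}(G)=G$ and $R_{q,k}(G)=R_q(R_{q,k-1}(G))$ for $k\ge1$. The resistance distance $r_{ij}$ between nodes $i,j$ of a simple connected graph is the effective resistance between them when every edge is replaced by a unit resistor. With $d_i$ the degree of node $i$ and sums over unordered pairs of distinct nodes: the additive degree-Kirchhoff index is $\bar{\mathcal K}(G)=\sum_{\{i,j\}\subseteq V(G)}(d_i+d_j)r_{ij}$ and the multiplicative degree-Kirchhoff index is $\hat{\mathcal K}(G)=\sum_{\{i,j\}\subseteq V(G)}d_id_jr_{ij}$. *)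

(* Defs.v *)
From mathcomp Require Import all_boot all_order all_algebra.
From mathcomp Require Import boolp classical_sets ring.

Set Implicit Arguments.
Unset Strict Implicit.
Unset Printing Implicit Defensive.

Import Order.TTheory GRing.Theory Num.Theory.

Local Open Scope ring_scope.

(* Finite simple graphs, bundled with their vertex type because the iterated
   construction changes it at every step. *)
Record sgraph := SGraph {
  vertex :> finType;
  adj : rel vertex;
  adj_sym : symmetric adj;
  adj_irrefl : irreflexive adj
}.

(* The null graph is not connected. *)
Definition connected (G : sgraph) : bool :=
  (0 < #|G|)%N && [forall x : G, forall y : G, connect (@adj G) x y].

Definition edges (G : sgraph) : {set {set G}} :=
  [set [set p.1; p.2] | p : G * G & adj p.1 p.2].

Definition degree (G : sgraph) (x : G) : nat := #|[set y | adj x y]|.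

Section Triangulation.
Variables (q : nat) (G : sgraph).

Definition edge_of : finType := {A : {set G} | A \in edges G}.

(* [inr (e, i)] is the middle node of the i-th path added along the edge e. *)
Definition tri_vertex : finType := (G + edge_of * 'I_q)%type.

Definition tri_adj : rel tri_vertex := fun a b =>
  match a, b with
  | inl u, inl v => adj u v
  | inl u, inr (e, _) => u \in val e
  | inr (e, _), inl v => v \in val e
  | inr _, inr _ => false
  end.

Lemma tri_adj_sym : symmetric tri_adj.
Proof. by move=> [u|[e i]] [v|[f j]] //=; apply: adj_sym. Qed.

Lemma tri_adj_irrefl : irreflexive tri_adj.
Proof. by move=> [u|[e i]] //=; apply: adj_irrefl. Qed.

Definition triangulation : sgraph := SGraph tri_adj_sym tri_adj_irrefl.

End Triangulation.

Definition iter_triangulation (q k : nat) (G : sgraph) : sgraph :=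
  iter k (triangulation q) G.

(* Kirchhoff's current law, with Ohm's law for unit resistors: v is a potential
   on the nodes when a unit current enters at i and leaves at j. *)
Definition unit_current_potential (R : realFieldType) (G : sgraph) (i j : G)
    (v : {ffun G -> R}) : Prop :=
  forall x : G,
    \sum_(y | adj x y) (v x - v y) = (x == i)%:R - (x == j)%:R.

(* In a connected graph such a potential exists and is unique up to a constant
   (see [resistanceE] and [unit_current_potential_exists] below). *)
Definition resistance (R : realFieldType) (G : sgraph) (i j : G) : R :=
  let v := xget [ffun => 0] [set v : {ffun G -> R} | unit_current_potential i j v]%classic in
  v i - v j.

(* [enum_rank i < enum_rank j] selects one representative (i, j) of each
   unordered pair of distinct nodes. *)
Definition additive_degree_kirchhoff (R : realFieldType) (G : sgraph) : R :=
  \sum_(i : G) \sum_(j : G | (enum_rank i < enum_rank j)%N)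
    (degree i + degree j)%:R * resistance R i j.

Definition multiplicative_degree_kirchhoff (R : realFieldType) (G : sgraph) : R :=
  \sum_(i : G) \sum_(j : G | (enum_rank i < enum_rank j)%N)
    (degree i * degree j)%:R * resistance R i j.

Section ResistanceTheory.
Variables (R : realFieldType) (G : sgraph).
Hypothesis G_connected : connected G.

Lemma harmonic_const (v : G -> R) :
  (forall x, \sum_(y | adj x y) (v x - v y) = 0) -> forall x y, v x = v y.
Proof.
case/andP: G_connected => _ /forallP Gc hv.
have E0 : \sum_x \sum_(y | adj x y) (v x - v y) ^+ 2 = 0.
  have E1 : \sum_x \sum_(y | adj x y) v x * (v x - v y) = 0.
    by rewrite big1 // => x _; rewrite -mulr_sumr hv mulr0.
  have E2 : \sum_x \sum_(y | adj x y) v y * (v x - v y) = 0.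
    rewrite (exchange_big_dep predT) //= big1 // => y _.
    under eq_bigl => x do rewrite adj_sym.
    rewrite -mulr_sumr -[X in _ * X]opprK -sumrN.
    under eq_bigr => x _ do rewrite opprB.
    by rewrite hv oppr0 mulr0.
  have := congr2 (fun s t => s - t) E1 E2; rewrite subrr /=; apply: etrans.
  rewrite -sumrB; apply: eq_bigr => x _.
  by rewrite -sumrB; apply: eq_bigr => y _; rewrite -mulrBl expr2.
have adjE x y : adj x y -> v x = v y.
  move=> xy; have nn z : 0 <= \sum_(t | adj z t) (v z - v t) ^+ 2.
    by apply: sumr_ge0 => t _; apply: sqr_ge0.
  have := psumr_eq0P (fun z _ => nn z) E0 => /(_ x isT) Ex.
  have := psumr_eq0P (fun t _ => sqr_ge0 (v x - v t)) Ex => /(_ y xy) /eqP.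
  by rewrite sqrf_eq0 subr_eq0 => /eqP.
move=> x y; have /forallP/(_ y)/connectP[p] := Gc x.
elim: p x => [|z p IH] x /=; first by move=> _ ->.
by case/andP=> xz pz yE; rewrite (adjE _ _ xz); apply: IH.
Qed.

Lemma unit_current_potential_exists (i j : G) :
  exists v : {ffun G -> R}, unit_current_potential i j v.
Proof.
pose L : 'M[R]_#|G| := \matrix_(a, b)
  ((a == b)%:R * (degree (enum_val a))%:R - (adj (enum_val a) (enum_val b))%:R).
have LE (v : G -> R) a : \sum_b L a b * v (enum_val b) =
    \sum_(y | adj (enum_val a) y) (v (enum_val a) - v y).
  rewrite sumrB sumr_const.
  under eq_bigr => b _ do rewrite mxE mulrBl.
  rewrite sumrB; congr (_ - _).
    rewrite (bigD1 a) //= eqxx mul1r big1 ?addr0 => [|b /negPf].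
      by rewrite mulr_natl; congr (_ *+ _); apply: eq_card => y; rewrite !inE.
    by rewrite eq_sym => ->; rewrite !mul0r.
  rewrite [RHS]big_mkcond [RHS](reindex (@enum_val _ predT)) /=.
    by apply: eq_bigr => b _; case: adj; rewrite ?mul1r ?mul0r.
  exact/onW_bij/enum_val_bij.
have Lsym a b : L a b = L b a.
  by rewrite !mxE adj_sym eq_sym; case: eqP => [->|_]; rewrite ?mul0r.
pose b0 : 'rV[R]_#|G| := \row_a ((enum_val a == i)%:R - (enum_val a == j)%:R).
have : (b0 <= L)%MS.
  rewrite submxE; apply/eqP/matrixP => r c; rewrite ord1 !mxE; set K := cokermx L.
  pose w x := K (enum_rank x) c.
  have wc x y : w x = w y.
    apply: harmonic_const => {}x; have := LE w (enum_rank x); rewrite enum_rankK => <-.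
    have := mulmx_coker L => /matrixP/(_ (enum_rank x) c).
    rewrite [LHS]mxE [RHS]mxE; apply: etrans.
    by apply: eq_bigr => b _; rewrite /w enum_valK.
  have KE a : K a c = w i by rewrite (wc i (enum_val a)) /w enum_valK.
  under eq_bigr => a _ do rewrite KE mxE.
  rewrite -mulr_suml sumrB.
  have s1 k : \sum_(a < #|G|) (enum_val a == k)%:R = 1 :> R.
    rewrite (bigD1 (enum_rank k)) //= enum_rankK eqxx big1 ?addr0 // => a.
    by rewrite -(inj_eq enum_val_inj) enum_rankK => /negPf ->.
  by rewrite !s1 subrr mul0r.
case/submxP => u b0E; exists [ffun x => u 0 (enum_rank x)] => x.
have := LE [ffun x => u 0 (enum_rank x)] (enum_rank x); rewrite enum_rankK => <-.
have := b0E => /rowP/(_ (enum_rank x)); rewrite [LHS]mxE [RHS]mxE enum_rankK => ->.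
by apply: eq_bigr => a _; rewrite ffunE enum_valK mulrC Lsym.
Qed.

Lemma resistanceE (i j : G) (v : {ffun G -> R}) :
  unit_current_potential i j v -> resistance R i j = v i - v j.
Proof.
move=> hv; rewrite /resistance /=; case: xgetP => [w _ /= hw|/(_ v)//].
have wv x y : w x - v x = w y - v y.
  apply: (harmonic_const (v := fun x => w x - v x)) => {}x.
  transitivity (\sum_(y | adj x y) (w x - w y) - \sum_(y | adj x y) (v x - v y)).
    by rewrite -sumrB; apply: eq_bigr => t _; ring.
  by rewrite hw hv subrr.
by have /eqP := wv i j; rewrite subr_eq => /eqP ->; ring.
Qed.

End ResistanceTheory.

(* Main.v *)
Require Import Defs.
From mathcomp Require Import all_boot all_order all_algebra ring.

(** Everything reduces to a single triangulation step. Write [c = 2 / (q + 2)].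

    For the currents between old nodes, the [q] paths along an edge [uv] amount
    to one resistor of conductance [q / 2] parallel to [uv], so the edge has
    conductance [1 + q / 2 = 1 / c] and old resistances are multiplied by [c].
    A new node sits electrically at the midpoint of its edge, plus a series
    resistance: off the diagonal, the resistance between any two nodes of the
    triangulation is [c] times the average of the old resistances over the
    nodes that they stand for (a node of [G] for itself, a new node for the two
    ends of its edge), plus an offset for each new node involved
    ([triangulation_resistance]). This is read off from an explicit inverse,
    modulo constants, of the Laplacian of the triangulation, built from one of
    [G] ([green_kernel_triangulation]).

    Both Kirchhoff indices are sums of [w1 a * w2 b * r a b] over ordered pairs,
    with weights [degree] or [1]. Averaging transposes to a push-forward of the
    weights to [G] ([sum_average]): the degree of the triangulation is pushed to
    [(2 q + 1) * degree], and the weight 1 to [1 + q / 2 * degree]. The offsets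
    involve the resistances only through their sum over the edges, which is
    [#|G| - 1] by Foster's theorem ([foster]). Hence the additive index of the
    triangulation is an explicit affine combination of both indices of [G], and
    its multiplicative index one of the multiplicative index of [G] alone
    ([additive_degree_kirchhoff_triangulation] and
    [multiplicative_degree_kirchhoff_triangulation]).

    The closed form follows by induction on [k], peeling off the innermost step:
    the induction hypothesis is applied to the triangulation of [G], so that
    only an identity of rational functions in [q], the sizes, the indices of [G]
    and the powers [a ^+ k], [(2 q + 1) ^+ k] remains. In this way no closed
    form for the multiplicative index is needed. *)

Set Implicit Arguments.
Unset Strict Implicit.
Unset Printing Implicit Defensive.

Import Order.TTheory GRing.Theory Num.Theory.
Local Open Scope ring_scope.

(** * Counting incidences of nodes and edges *)

Section Incidence.
Variables (T : Type) (idx : T) (op : Monoid.com_law idx) (G : sgraph).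

Lemma edges_at (u : G) :
  [set A in edges G | u \in A] = [set [set u; y] | y in [set y | adj u y]].
Proof.
apply/setP => A; rewrite inE; apply/andP/imsetP => [[]|[y]].
  case/imsetP => -[s t]; rewrite inE /= => st ->.
  rewrite !inE => /orP[]/eqP->; first by exists t; rewrite ?inE.
  by exists s; rewrite ?inE 1?adj_sym // setUC.
rewrite inE => uy ->; split; last by rewrite !inE eqxx.
by apply/imsetP; exists (u, y); rewrite ?inE.
Qed.

Lemma adj_neq (x y : G) : adj x y -> x != y.
Proof. by apply: contraTneq => ->; rewrite adj_irrefl. Qed.

Lemma big_edge (f : G -> T) (u v : G) : adj u v ->
  \big[op/idx]_(s in [set u; v]) f s = op (f u) (f v).
Proof. by move=> uv; rewrite big_setU1 ?big_set1 // inE adj_neq. Qed.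

Lemma big_edges_at (u : G) (F : {set G} -> T) :
  \big[op/idx]_(A in edges G | u \in A) F A =
  \big[op/idx]_(y | adj u y) F [set u; y].
Proof.
rewrite (eq_bigl (mem [set A in edges G | u \in A])) => [|A].
  rewrite edges_at big_imset => [|y z] /=.
    by apply: eq_bigl => y; rewrite inE.
  rewrite !inE => uy uz /setP/(_ y).
  by rewrite !inE eqxx orbT eq_sym (negPf (adj_neq uy)) => /esym/eqP.
by rewrite !inE.
Qed.

Lemma big_edge_of_at (u : G) (F : {set G} -> T) :
  \big[op/idx]_(e : edge_of G | u \in val e) F (val e) =
  \big[op/idx]_(y | adj u y) F [set u; y].
Proof.
by rewrite -(big_sub_cond (mem (edges G)) (fun A => u \in A)) big_edges_at.
Qed.

(** Double counting of the pairs (node, edge at that node); the edges at [u]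
    are enumerated by their other ends. *)
Lemma exchange_incidence (F : G -> {set G} -> T) :
  \big[op/idx]_(A in edges G) \big[op/idx]_(u in A) F u A =
  \big[op/idx]_u \big[op/idx]_(y | adj u y) F u [set u; y].
Proof.
rewrite (exchange_big_dep predT) //=.
by apply: eq_bigr => u _; rewrite big_edges_at.
Qed.

Lemma card_edge (A : {set G}) : A \in edges G -> #|A| = 2.
Proof.
by case/imsetP => -[s t]; rewrite inE /= => /adj_neq st ->; rewrite cards2 st.
Qed.

End Incidence.

Lemma degree_sum (G : sgraph) (x : G) : degree x = (\sum_(y | adj x y) 1)%N.
Proof. by rewrite sum1dep_card. Qed.

Lemma card_edge_of (G : sgraph) : #|{: edge_of G}| = #|edges G|.
Proof. by rewrite card_sig; apply: eq_card => A; rewrite !inE. Qed.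

Lemma handshake (G : sgraph) : (\sum_(u : G) degree u = 2 * #|edges G|)%N.
Proof.
under eq_bigr => u _ do rewrite degree_sum.
rewrite -(exchange_incidence _ (fun _ _ => 1%N)).
rewrite (eq_bigr (fun=> 2)) => [|A /card_edge EA]; last by rewrite sum1_card.
by rewrite sum_nat_const mulnC.
Qed.

(** * Neighbourhoods, sizes and connectedness of the triangulation *)

Section Triangulation.
Variables (q : nat) (G : sgraph).

Section BigOp.
Variables (T : Type) (idx : T) (op : Monoid.com_law idx).

Lemma big_tri_adj_old (u : G) (F : triangulation q G -> T) :
  \big[op/idx]_(y | adj (inl u : triangulation q G) y) F y =
  op (\big[op/idx]_(v | adj u v) F (inl v))
     (\big[op/idx]_(e : edge_of G | u \in val e)
        \big[op/idx]_(i < q) F (inr (e, i))).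
Proof.
rewrite big_sumType /=; congr (op _ _); rewrite pair_big_dep /=.
by apply: eq_big => [[e i]|[e i]] //=; rewrite andbT.
Qed.

Lemma big_tri_adj_new (e : edge_of G) i (F : triangulation q G -> T) :
  \big[op/idx]_(y | adj (inr (e, i) : triangulation q G) y) F y =
  \big[op/idx]_(v in val e) F (inl v).
Proof.
by rewrite big_sumType /= [X in op _ X]big_pred0 ?Monoid.mulm1 // => -[].
Qed.

Lemma big_tri (F : triangulation q G -> T) :
  \big[op/idx]_a F a = op (\big[op/idx]_u F (inl u))
    (\big[op/idx]_(e : edge_of G) \big[op/idx]_(i < q) F (inr (e, i))).
Proof.
rewrite big_sumType /=; congr (op _ _); rewrite pair_big /=.
by apply: eq_bigr => -[].
Qed.

End BigOp.

Lemma degree_old (u : G) :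
  degree (inl u : triangulation q G) = (q.+1 * degree u)%N.
Proof.
rewrite degree_sum big_tri_adj_old /= -degree_sum mulSn; congr (_ + _)%N.
under eq_bigr => e _ do rewrite sum1_card card_ord.
rewrite (big_edge_of_at _ u (fun=> q)) sum_nat_cond_const mulnC.
by congr (_ * _)%N.
Qed.

Lemma degree_new (e : edge_of G) i :
  degree (inr (e, i) : triangulation q G) = 2.
Proof. by rewrite degree_sum big_tri_adj_new sum1_card card_edge ?(valP e). Qed.

Lemma card_triangulation : #|triangulation q G| = (#|G| + q * #|edges G|)%N.
Proof. by rewrite card_sum card_prod card_edge_of card_ord mulnC. Qed.

(** Obtained from the degrees by the handshake identity, which avoids describing
    the edge set of the triangulation. *)
Lemma card_edges_triangulation :
  #|edges (triangulation q G)| = ((2 * q).+1 * #|edges G|)%N.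
Proof.
apply/eqP; rewrite -(eqn_pmul2l (isT : 0 < 2)%N) -handshake big_tri /=.
under eq_bigr => u _ do rewrite degree_old.
under [X in (_ + X)%N]eq_bigr => e _.
  under eq_bigr => i _ do rewrite degree_new.
  rewrite sum_nat_const card_ord; over.
rewrite -big_distrr /= handshake sum_nat_const card_edge_of; apply/eqP.
set m := #|edges G|; clearbody m.
ring.
Qed.

Lemma triangulation_connected : connected G -> connected (triangulation q G).
Proof.
case/andP => G0 /forallP Gc; apply/andP; split.
  by rewrite card_triangulation addn_gt0 G0.
have old (u v : G) : connect (@adj (triangulation q G)) (inl u) (inl v).
  have /forallP/(_ v)/connectP[p] := Gc u.
  elim: p u => [|z p IH] u /= => [_ ->|/andP[uz pz vE]]; first exact: connect0.
  by apply: connect_trans (IH _ pz vE); apply: connect1.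
have near (a : triangulation q G) :
    exists u : G, connect (@adj (triangulation q G)) a (inl u).
  case: a => [u|[e i]]; first by exists u; exact: connect0.
  have /card_gt0P[u ue] : (0 < #|val e|)%N by rewrite card_edge ?(valP e).
  by exists u; apply: connect1.
apply/forallP => a; apply/forallP => b.
have [[u au] [v bv]] := (near a, near b).
apply: connect_trans au (connect_trans (old u v) _).
by rewrite (sym_connect_sym (@adj_sym _)).
Qed.

End Triangulation.

(** * Resistances from a Green kernel *)

(** With [f i j] of the form [degree i * r i j] this turns the sums over unordered
    pairs into sums over ordered pairs, in which the two summations separate. *)
Lemma sum_ltn_rank (V : nmodType) (T : finType) (f : T -> T -> V) :
    (forall i, f i i = 0) ->
  \sum_i \sum_(j | (enum_rank i < enum_rank j)%N) (f i j + f j i) =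
  \sum_i \sum_j f i j.
Proof.
move=> f0; under eq_bigr => i _ do rewrite big_split /=.
rewrite big_split /= [X in _ + X](exchange_big_dep predT) //= -big_split /=.
apply: eq_bigr => i _.
rewrite [RHS](bigID (fun j => enum_rank i < enum_rank j)%N) /=; congr (_ + _).
rewrite [RHS](bigD1 i) ?ltnn //= f0 add0r; apply: eq_bigl => j.
by rewrite -leqNgt ltn_neqAle (inj_eq val_inj) (inj_eq enum_rank_inj) andbC.
Qed.

Lemma sum_indicator (R : pzSemiRingType) (T : finType) (A : {set T})
    (u : T) :
  \sum_(s in A) (u == s)%:R = (u \in A)%:R :> R.
Proof.
have [uA|uA] := boolP (u \in A); last first.
  by rewrite big1 // => s sA; case: eqP uA => // ->; rewrite sA.
rewrite (bigD1 u) //= eqxx big1 ?addr0 // => s /andP[_].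
by rewrite eq_sym => /negPf->.
Qed.

Lemma natr_doubleS (R : pzSemiRingType) q : (2 * q).+1%:R = 2 * q%:R + 1 :> R.
Proof. by rewrite -addn1 natrD natrM. Qed.

Lemma natrD2_neq0 (R : numDomainType) q : q%:R + 2 != 0 :> R.
Proof. by rewrite -natrD pnatr_eq0 addn2. Qed.

Section GreenKernel.
Variable R : realFieldType.

(** The column [g ^~ j] is the potential when a unit current enters at [j] and
    leaves spread out as [c], the same [c] for every [j]. Such a [g] inverts the
    Laplacian up to constants; leaving [c] free makes the notion stable under
    the passage to the triangulation. *)
Definition green_kernel (G : sgraph) (g : G -> G -> R) (c : G -> R) : Prop :=
  forall x j : G, \sum_(y | adj x y) (g x j - g y j) = (x == j)%:R - c x.

(** Drain all the current at one fixed node. *)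
Lemma green_kernel_exists (G : sgraph) :
  connected G -> exists g c, @green_kernel G g c.
Proof.
move=> Gc; have /andP[/card_gt0P[o _] _] := Gc.
have /fin_all_exists[v hv] j := unit_current_potential_exists R Gc j o.
by exists (fun x j => v j x), (fun x => (x == o)%:R) => x j; apply: hv.
Qed.

Section Connected.
Variables (G : sgraph) (g : G -> G -> R) (c : G -> R).
Hypotheses (Gc : connected G) (gc : green_kernel g c).

(** In the difference of the columns of [i] and [j] the drains cancel, which
    leaves a potential for the unit current from [i] to [j]. *)
Lemma resistance_green i j :
  resistance R i j = g i i + g j j - g i j - g j i.
Proof.
rewrite (@resistanceE _ _ Gc _ _ [ffun x => g x i - g x j]).
  by rewrite !ffunE; ring.
move=> x; transitivity (((x == i)%:R - c x) - ((x == j)%:R - c x));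
  last by ring.
by rewrite -!gc -sumrB; apply: eq_bigr => y _; rewrite !ffunE; ring.
Qed.

(** No current is lost: a Laplacian has total sum zero. *)
Lemma sum_drain : \sum_x c x = 1.
Proof.
have /andP[/card_gt0P[o _] _] := Gc.
have : \sum_x \sum_(y | adj x y) (g x o - g y o) = 0.
  under eq_bigr => x _ do rewrite sumrB.
  rewrite sumrB [X in _ - X](exchange_big_dep predT) //= -sumrB big1 // => x _.
  by rewrite [X in _ - X](eq_bigl (adj x)) ?subrr // => y; rewrite adj_sym.
under eq_bigr => x _ do rewrite gc.
rewrite sumrB (bigD1 o) //= eqxx big1 ?addr0 => [/eqP|x /negPf -> //].
by rewrite subr_eq0 => /eqP.
Qed.

(** Along an edge, [r x y] is the sum of the drops [g x x - g y x] and
    [g y y - g x y]; for each [x], the drops to its neighbours add up to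
    [1 - c x] by the defining equation at the source. Each edge is counted
    twice, as [(x, y)] and as [(y, x)]. *)
Lemma foster_green :
  \sum_(x : G) \sum_(y | adj x y) resistance R x y = 2 * (#|G|%:R - 1).
Proof.
have E : \sum_x \sum_(y | adj x y) (g x x - g y x) = #|G|%:R - 1.
  under eq_bigr => x _ do rewrite gc eqxx.
  by rewrite sumrB sumr_const sum_drain.
rewrite mulr_natl mulr2n -{1}E -E [X in _ + X](exchange_big_dep predT) //=.
rewrite -big_split; apply: eq_bigr => x _ /=.
rewrite [X in _ + X](eq_bigl (adj x)) => [|y]; last by rewrite adj_sym.
by rewrite -big_split; apply: eq_bigr => y _ /=; rewrite resistance_green; ring.
Qed.

End Connected.

Section Resistance.
Variable G : sgraph.
Hypothesis Gc : connected G.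

Lemma resistancexx (i : G) : resistance R i i = 0.
Proof.
have [g [c gc]] := green_kernel_exists Gc.
by rewrite (resistance_green Gc gc); ring.
Qed.

Lemma resistanceC (i j : G) : resistance R i j = resistance R j i.
Proof.
have [g [c gc]] := green_kernel_exists Gc.
by rewrite !(resistance_green Gc gc); ring.
Qed.

(** Foster's theorem, over ordered pairs of neighbours. *)
Lemma foster :
  \sum_(x : G) \sum_(y | adj x y) resistance R x y = 2 * (#|G|%:R - 1).
Proof.
by have [g [c gc]] := green_kernel_exists Gc; apply: foster_green gc.
Qed.

Lemma additive_degree_kirchhoffE : additive_degree_kirchhoff R G =
  \sum_(i : G) \sum_(j : G) (degree i)%:R * resistance R i j.
Proof.
rewrite -(@sum_ltn_rank _ _ (fun i j => _ * _)) => [|i]; last first.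
  by rewrite resistancexx mulr0.
apply: eq_bigr => i _; apply: eq_bigr => j _.
by rewrite (resistanceC j i) natrD mulrDl.
Qed.

Lemma multiplicative_degree_kirchhoffE :
  2 * multiplicative_degree_kirchhoff R G =
  \sum_(i : G) \sum_(j : G) (degree i)%:R * (degree j)%:R * resistance R i j.
Proof.
rewrite -(@sum_ltn_rank _ _ (fun i j => _ * _ * _)) => [|i]; last first.
  by rewrite resistancexx mulr0.
rewrite mulr_sumr; apply: eq_bigr => i _; rewrite mulr_sumr.
by apply: eq_bigr => j _; rewrite (resistanceC j i) natrM; ring.
Qed.

End Resistance.
End GreenKernel.

(** * Averaging over the ends of an edge *)

Section Average.
Variables (R : realFieldType) (q : nat) (G : sgraph).
Local Notation T := (triangulation q G).

(** The harmonic extension of [f] to the new nodes: no current enters or leaves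
    at a node whose potential is the mean of those of its two neighbours. *)
Definition average (f : G -> R) (a : T) : R :=
  match a with inl u => f u | inr (e, _) => (\sum_(u in val e) f u) / 2 end.

Definition average2 (f : G -> G -> R) (a b : T) : R :=
  average (fun s => average (f s) b) a.

Definition is_new (a : T) : bool := if a is inr _ then true else false.

Lemma eq_average f1 f2 : f1 =1 f2 -> average f1 =1 average f2.
Proof. by move=> f12 [u|[e i]] /=; rewrite ?f12 // (eq_bigr f2). Qed.

Lemma average_cst k a : average (fun=> k) a = k.
Proof.
by case: a => [u|[e i]] //=; rewrite sumr_const card_edge ?(valP e) //; field.
Qed.

Lemma averageB f1 f2 a :
  average (fun s => f1 s - f2 s) a = average f1 a - average f2 a.
Proof. by case: a => [u|[e i]] //=; rewrite sumrB mulrBl. Qed.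

Lemma averageD f1 f2 a :
  average (fun s => f1 s + f2 s) a = average f1 a + average f2 a.
Proof. by case: a => [u|[e i]] //=; rewrite big_split mulrDl. Qed.

Lemma averageZ k f a : average (fun s => k * f s) a = k * average f a.
Proof. by case: a => [u|[e i]] //=; rewrite -mulr_sumr mulrA. Qed.

Lemma average_sum I (r : seq I) (P : pred I) (F : I -> G -> R) a :
  average (fun s => \sum_(i <- r | P i) F i s) a =
  \sum_(i <- r | P i) average (F i) a.
Proof.
by case: a => [u|[e i]] //=; rewrite exchange_big /= -mulr_suml.
Qed.

Lemma average2C f a b :
  average2 f a b = average2 (fun s t => f t s) b a.
Proof.
rewrite /average2; case: a => [u|[e i]] //=.
by rewrite -average_sum mulrC -averageZ; apply: eq_average => s; rewrite mulrC.
Qed.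

(** The transpose of averaging. Each of the [q] new nodes on an edge gives half
    of its weight [k] to each end, so [u] receives [k * q / 2] per edge. *)
Lemma sum_average (w : T -> R) (k : R) (f : G -> R) :
    (forall e i, w (inr (e, i)) = k) ->
  \sum_a w a * average f a =
  \sum_u (w (inl u) + k * q%:R / 2 * (degree u)%:R) * f u.
Proof.
move=> wk; rewrite big_tri /=.
transitivity (\sum_u w (inl u) * f u
    + k * q%:R / 2 * \sum_(e : edge_of G) \sum_(u in val e) f u).
  congr (_ + _); rewrite mulr_sumr; apply: eq_bigr => e _.
  under eq_bigr => i _ do rewrite wk.
  by rewrite sumr_const card_ord -mulr_natl; field.
rewrite -(big_sub (mem (edges G)) (fun A => \sum_(u in A) f u)).
rewrite exchange_incidence mulr_sumr -big_split; apply: eq_bigr => u _ /=.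
rewrite mulrDl -!mulrA; congr (_ + _ * (_ * (_ * _))).
by rewrite degree_sum natr_sum mulr_suml; apply: eq_bigr => y _; rewrite mul1r.
Qed.
End Average.

(** * Resistances in the triangulation *)

Section TriangulationResistance.
Variables (R : realFieldType) (q : nat) (G : sgraph).
Hypothesis Gc : connected G.
Local Notation T := (triangulation q G).
Local Notation cq := (2 / (q%:R + 2) : R).
Let q2_neq0 := natrD2_neq0 R q.

(** The last term is the response of a new node to a current entering there: it
    is joined to the rest by two unit resistors in parallel. *)
Definition triangulation_kernel (g : G -> G -> R) (a b : T) : R :=
  cq * average2 g a b + ((a == b) && is_new a)%:R / 2.

(** Harmonic extension makes the equation hold at the new nodes. At an old node
    [u], each of the [q] paths along an edge [uv] carries half of the drop from
    [u] to [v], so the Laplacian of [G] is multiplied by [1 + q / 2], which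
    the factor [2 / (q + 2)] compensates. A source at a new node is seen from
    [G] as half a source at each end of the edge, which the current out of the
    new node cancels. *)
Lemma green_kernel_triangulation (g : G -> G -> R) (c : G -> R) :
  green_kernel g c ->
  green_kernel (triangulation_kernel g)
    (fun a => if a is inl u then c u else 0).
Proof.
move=> gc a b; set phi := fun s => cq * average (g s) b.
have phiE x : triangulation_kernel g x b =
    average phi x + ((x == b) && is_new x)%:R / 2.
  by rewrite /triangulation_kernel averageZ.
under eq_bigr => y _ do rewrite !phiE.
case: a => [u|[e i]]; last first.
  rewrite big_tri_adj_new /= andbT.
  under eq_bigr => v _ do rewrite andbF mul0r addr0.
  rewrite sumrB sumr_const card_edge ?(valP e) //.
  by field.
(* The source at [b], averaged onto [G], and the drain of [g]. *)
have lap_phi : \sum_(v | adj u v) (phi u - phi v) =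
    cq * (average (fun j => (u == j)%:R) b - c u).
  rewrite -[X in _ - X](average_cst (c u) b) -averageB.
  rewrite (eq_average (f2 := fun j => \sum_(v | adj u v) (g u j - g v j))) //.
  rewrite average_sum mulr_sumr; apply: eq_bigr => v _.
  by rewrite averageB mulrBr.
clearbody phi.
(* The flow from [u] into one layer of paths, one path for each edge at [u]. *)
have half : \sum_(e : edge_of G | u \in val e)
      (phi u - (\sum_(s in val e) phi s) / 2)
    = (\sum_(v | adj u v) (phi u - phi v)) / 2.
  rewrite (big_edge_of_at _ u (fun A => phi u - (\sum_(s in A) phi s) / 2)).
  by rewrite mulr_suml; apply: eq_bigr => v uv; rewrite big_edge //=; field.
(* Only the node [b] itself deviates from harmonic extension, and only if it is
   a new neighbour of [u]. *)
have source : \sum_(e : edge_of G | u \in val e) \sum_(i < q)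
      ((inr (e, i) : T) == b)%:R =
    (if b is inr (e, _) then (u \in val e)%:R else 0) :> R.
  rewrite pair_big_dep /=; case: b {phiE lap_phi half} => [t|[e i]].
    by rewrite big1 // => -[].
  case: (boolP (u \in val e)) => ue; last first.
    rewrite big1 // => -[f j] /=; rewrite andbT => uf.
    by case: eqP ue => // -[<- _]; rewrite uf.
  rewrite (bigD1 (e, i)) /= ?ue // eqxx big1 ?addr0 // => -[f j] /andP[_ fe].
  by rewrite [_ == _](negPf fe).
rewrite big_tri_adj_old /=.
under eq_bigr => v _ do rewrite !andbF !mul0r !addr0.
under [X in _ + X]eq_bigr => e _.
  under eq_bigr => i _ do rewrite andbF andbT mul0r addr0 opprD addrA.
  rewrite sumrB sumr_const card_ord -mulr_suml; over.
move: half source => /= half source.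
rewrite /= [X in _ + X]sumrB -mulr_suml source sumrMnl half lap_phi.
case: b {phiE half source} lap_phi => [t|[e i]] /= lap_phi.
  by field.
by rewrite sum_indicator; case: (u \in _); field.
Qed.

(** On an old node this is 0. On a new node on the edge [uv] it is
    [1 / 2 - c * r u v / 4], where [c = 2 / (q + 2)]: the two parallel unit
    resistors, minus the correction for replacing the midpoint of [uv] by the
    average of its ends. *)
Definition new_offset (a : T) : R :=
  ((is_new a)%:R - cq * average2 (@resistance R G) a a) / 2.

(** The subtracted indicator only makes the diagonal vanish at the new nodes,
    where the other terms add up to 1. *)
Lemma triangulation_resistance (a b : T) :
  resistance R a b =
  new_offset a + new_offset b
  + cq * average2 (@resistance R G) a b - ((a == b) && is_new a)%:R.
Proof.
have [g [c gc]] := green_kernel_exists R Gc.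
have Tc : connected T := triangulation_connected q Gc.
rewrite (resistance_green Tc (green_kernel_triangulation gc)).
pose D := average (fun s => g s s) : T -> R.
have avg2 x y : average2 (@resistance R G) x y =
    D x + D y - average2 g x y - average2 g y x.
  rewrite [average2 g y x]average2C /average2.
  under eq_average => s.
    under eq_average => t do rewrite (resistance_green Gc gc).
    rewrite !averageB averageD average_cst; over.
  by rewrite !averageB averageD average_cst.
rewrite /new_offset !avg2 /triangulation_kernel !eqxx /= (eq_sym b a).
case: eqP => [->|_] /=; last by field.
by case: (is_new b); field.
Qed.

(** Averaging both arguments over the ends of an edge [uv] gives
    [r u v / 2], so Foster's theorem applies. *)
Lemma sum_average2_diag :
  \sum_(a : T) average2 (@resistance R G) a a = q%:R * (#|G|%:R - 1) / 2 :> R.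
Proof.
rewrite big_tri /= /average2 /=.
rewrite big1 ?add0r => [|u _]; last by rewrite resistancexx.
under eq_bigr => e _.
  under eq_bigr => i _ do rewrite -mulr_suml.
  rewrite sumr_const card_ord; over.
rewrite /= sumrMnl -!mulr_suml.
rewrite -(big_sub (mem (edges G))
  (fun A => \sum_(s in A) \sum_(t in A) resistance R s t)).
rewrite exchange_incidence.
have -> : \sum_(s : G) \sum_(t | adj s t)
      \sum_(u in [set s; t]) resistance R s u =
    2 * (#|G|%:R - 1) :> R.
  rewrite -(foster R Gc); apply: eq_bigr => s _; apply: eq_bigr => t st.
  by rewrite big_edge //= resistancexx // add0r.
by rewrite -mulr_natr; field.
Qed.

End TriangulationResistance.

(** * One triangulation step for the Kirchhoff indices *)

Section Recursion.
Variables (R : realFieldType) (q : nat) (G : sgraph).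
Hypothesis Gc : connected G.
Local Notation T := (triangulation q G).
Local Notation cq := (2 / (q%:R + 2) : R).
Let q2_neq0 := natrD2_neq0 R q.
Local Notation nG := (#|G|%:R : R).
Local Notation mG := (#|edges G|%:R : R).
Local Notation Q := (q%:R : R).

Definition total_offset : R := (Q * mG - Q * (nG - 1) / (Q + 2)) / 2.

Lemma sum_new_weight (w F : T -> R) (k : R) :
    (forall e i, w (inr (e, i)) = k) -> (forall u, F (inl u) = 0) ->
  \sum_a w a * F a = k * \sum_a F a.
Proof.
move=> wk F0; rewrite mulr_sumr; apply: eq_bigr => -[u|[e i]] _.
  by rewrite F0 !mulr0.
by rewrite wk.
Qed.

Lemma sum_is_new : \sum_(a : T) (is_new a)%:R = Q * mG.
Proof.
rewrite big_tri /= big1 ?add0r //.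
by rewrite !sumr_const card_ord card_edge_of -mulrnA -natrM.
Qed.

Lemma sum_offset : \sum_(a : T) new_offset R a = total_offset.
Proof.
rewrite -mulr_suml sumrB -mulr_sumr sum_is_new sum_average2_diag //.
by rewrite /total_offset; field.
Qed.

(** The weight on [G] given by [sum_average]. *)
Definition push_weight (w : T -> R) (k : R) (s : G) : R :=
  w (inl s) + k * Q / 2 * (degree s)%:R.

(** The three parts of [triangulation_resistance], summed: the offsets live on
    the new nodes, where the weights are constant; the averaged part transposes
    to [G] in both arguments; the diagonal has one entry for each of the
    [q * #|edges G|] new nodes. *)
Lemma sum_triangulation_resistance (w1 w2 : T -> R) (k1 k2 : R) :
    (forall e i, w1 (inr (e, i)) = k1) -> (forall e i, w2 (inr (e, i)) = k2) ->
  \sum_a \sum_b w1 a * w2 b * resistance R a b =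
  (k1 * \sum_a w2 a + k2 * \sum_a w1 a) * total_offset
  + cq * \sum_s \sum_t
      push_weight w1 k1 s * push_weight w2 k2 t * resistance R s t
  - k1 * k2 * (Q * mG).
Proof.
move=> w1k w2k; pose h := @new_offset R q G.
have h0 u : h (inl u) = 0.
  by rewrite /h /new_offset /average2 /= resistancexx //; ring.
have sum_wh w k : (forall e i, w (inr (e, i)) = k) ->
    \sum_a w a * h a = k * total_offset.
  by move=> wk; rewrite -sum_offset; apply: sum_new_weight.
have quad : \sum_(a : T) \sum_(b : T)
      w1 a * w2 b * average2 (@resistance R G) a b =
    \sum_s \sum_t push_weight w1 k1 s * push_weight w2 k2 t * resistance R s t.
  under [RHS]eq_bigr => s _.
    under eq_bigr => t _ do rewrite -mulrA.
    rewrite -mulr_sumr -(sum_average _ w2k); over.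
  rewrite /= -(sum_average (fun s => \sum_b w2 b * average (resistance R s) b)
    w1k).
  apply: eq_bigr => a _; rewrite average_sum mulr_sumr; apply: eq_bigr => b _.
  by rewrite averageZ mulrA.
have diag : \sum_(a : T) \sum_(b : T) w1 a * w2 b * ((a == b) && is_new a)%:R =
    k1 * k2 * (Q * mG).
  rewrite -sum_is_new -(@sum_new_weight (fun a => w1 a * w2 a)) //; last first.
    by move=> e i; rewrite w1k w2k.
  apply: eq_bigr => a _; rewrite (bigD1 a) //= eqxx big1 ?addr0 // => b.
  by rewrite eq_sym => /negPf ->; rewrite mulr0.
rewrite -quad -diag.
transitivity ((\sum_a w1 a * h a) * (\sum_b w2 b)
   + (\sum_a w1 a) * (\sum_b w2 b * h b)
   + cq * (\sum_(a : T) \sum_(b : T)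
       w1 a * w2 b * average2 (@resistance R G) a b)
   - \sum_(a : T) \sum_(b : T)
       w1 a * w2 b * ((a == b) && is_new a)%:R); last first.
  by rewrite (sum_wh _ _ w1k) (sum_wh _ _ w2k); ring.
rewrite !mulr_suml mulr_sumr -!big_split -sumrB /=; apply: eq_bigr => a _.
rewrite !mulr_sumr -!big_split -sumrB /=; apply: eq_bigr => b _.
by rewrite triangulation_resistance // -/h; ring.
Qed.

(** The [q.+1 * degree s] of the old node [s], and [q * degree s] from the
    new nodes around it, which have degree 2. *)
Lemma push_degree s :
  push_weight (fun a : T => (degree a)%:R) 2 s = (2 * Q + 1) * (degree s)%:R.
Proof. by rewrite /push_weight degree_old natrM -natr1; field. Qed.

Lemma sum_degreeR (H : sgraph) :
  \sum_(x : H) (degree x)%:R = 2 * #|edges H|%:R :> R.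
Proof. by rewrite -natr_sum handshake natrM. Qed.

Lemma additive_degree_kirchhoff_triangulation :
  additive_degree_kirchhoff R T =
  2 * (2 * Q + 1) / (Q + 2)
    * (additive_degree_kirchhoff R G + Q * multiplicative_degree_kirchhoff R G)
  + (nG + Q * mG + (2 * Q + 1) * mG) * (Q * mG - Q * (nG - 1) / (Q + 2))
  - 2 * Q * mG.
Proof.
have Tc : connected T := triangulation_connected q Gc.
rewrite additive_degree_kirchhoffE //.
transitivity (\sum_(a : T) \sum_(b : T) (degree a)%:R * 1 * resistance R a b).
  by do 2!apply: eq_bigr => ? _; rewrite mulr1.
rewrite (@sum_triangulation_resistance (fun a => (degree a)%:R) (fun=> 1) 2 1)
  //; last first.
  by move=> e i; rewrite degree_new.
rewrite sum_degreeR sumr_const card_triangulation card_edges_triangulation.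
have -> : \sum_(s : G) \sum_(t : G) push_weight (fun a => (degree a)%:R) 2 s *
     push_weight (fun=> 1) 1 t * resistance R s t =
   (2 * Q + 1) * (additive_degree_kirchhoff R G
                  + Q * multiplicative_degree_kirchhoff R G).
  transitivity ((2 * Q + 1) * (additive_degree_kirchhoff R G
      + Q / 2 * (2 * multiplicative_degree_kirchhoff R G))); last by field.
  rewrite additive_degree_kirchhoffE // multiplicative_degree_kirchhoffE //.
  rewrite !mulr_sumr -big_split mulr_sumr; apply: eq_bigr => s _ /=.
  rewrite !mulr_sumr -big_split mulr_sumr; apply: eq_bigr => t _ /=.
  by rewrite push_degree /push_weight; ring.
by rewrite /total_offset !(natrD, natrM) natr_doubleS; field.
Qed.

Lemma multiplicative_degree_kirchhoff_triangulation :
  multiplicative_degree_kirchhoff R T =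
  2 * (2 * Q + 1) ^+ 2 / (Q + 2) * multiplicative_degree_kirchhoff R G
  + 2 * (2 * Q + 1) * mG * (Q * mG - Q * (nG - 1) / (Q + 2))
  - 2 * Q * mG.
Proof.
have Tc : connected T := triangulation_connected q Gc.
apply: (@mulfI R 2); first by rewrite pnatr_eq0.
rewrite multiplicative_degree_kirchhoffE //.
have deg2 e i : (degree (inr (e, i) : T))%:R = 2 :> R by rewrite degree_new.
rewrite (@sum_triangulation_resistance (fun a => (degree a)%:R) _ 2 2) //.
rewrite sum_degreeR card_edges_triangulation.
have -> : \sum_(s : G) \sum_(t : G) push_weight (fun a => (degree a)%:R) 2 s *
     push_weight (fun a => (degree a)%:R) 2 t * resistance R s t =
   (2 * Q + 1) ^+ 2 * (2 * multiplicative_degree_kirchhoff R G).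
  rewrite multiplicative_degree_kirchhoffE //.
  rewrite mulr_sumr; apply: eq_bigr => s _ /=.
  rewrite mulr_sumr; apply: eq_bigr => t _ /=.
  by rewrite !push_degree; ring.
by rewrite /total_offset !(natrD, natrM) natr_doubleS; field.
Qed.

End Recursion.

(** * The iterated triangulation *)

Theorem theorem11 (R : realFieldType) (G : sgraph) (n' m' q' k : nat)
    (hG : connected G) (hn : #|G| = n') (hm : #|edges G| = m')
    (hq : (1 <= q')%N) :
  let n : R := n'%:R in
  let m : R := m'%:R in
  let q : R := q'%:R in
  let Kadd0 : R := additive_degree_kirchhoff R G in
  let Kmul0 : R := multiplicative_degree_kirchhoff R G in
  let a : R := 2 * (2 * q + 1) / (q + 2) in
  let b : R := 2 * (2 * q + 1) ^+ 2 / (q + 2) in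
  additive_degree_kirchhoff R (iter_triangulation q' k G) =
    a ^+ k * Kadd0
    + (b ^+ k - a ^+ k)
      * (Kmul0 / 2
         - (2 * (q + 2) * m ^+ 2 + (2 * q + 1) * m * n - m * (q - 1))
           / (3 * (2 * q + 1)))
    + ((2 * q + 1) ^+ (2 * k) - a ^+ k)
      * (m ^+ 2 * (2 * q + 3) * (6 * q + 11) / (4 * (2 * q + 1) * (2 * q + 5)))
    + (a ^+ k - (2 * q + 1) ^+ k)
      * (m / (2 * (2 * q + 1))
         + (q + 2) * m * (m - 2 * n + 1) / (3 * (2 * q + 1)))
    - (a ^+ k - 1) * ((m - 2 * n) * (m - 2 * n + 2) / 12).
Proof.
elim: k G n' m' hG hn hm => [|k IH] G n' m' hG hn hm n m q Kadd0 Kmul0 a b.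
  by rewrite muln0 !expr0 !subrr !mul0r !addr0 subr0 mul1r.
have q_ge0 : 0 <= q by apply: ler0n.
have q2 : q + 2 != 0 by apply: lt0r_neq0; rewrite ltr_wpDl.
have q21 : 2 * q + 1 != 0 by apply: lt0r_neq0; rewrite ltr_wpDl ?mulr_ge0.
have q25 : 2 * q + 5 != 0 by apply: lt0r_neq0; rewrite ltr_wpDl ?mulr_ge0.
rewrite /iter_triangulation iterSr -/(iter_triangulation q' k _).
rewrite (IH _ _ _ (triangulation_connected q' hG)
  (card_triangulation q' G) (card_edges_triangulation q' G)).
rewrite additive_degree_kirchhoff_triangulation //.
rewrite multiplicative_degree_kirchhoff_triangulation //.
rewrite hn hm natrD !natrM natr_doubleS -/q -/n -/m -/Kadd0 -/Kmul0 -/a -/b.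
have -> : b = a * (2 * q + 1) by rewrite /a /b; field.
rewrite !(mulnC 2%N) !exprM !exprMn !exprS.
(* The powers are now free variables and the claim is an identity of rational
   functions. *)
set x := a ^+ k; set y := (2 * q + 1) ^+ k; clearbody x y.
rewrite /a; clearbody Kadd0 Kmul0 n m; clear -q2 q21 q25.
clearbody q.
field.
by rewrite q2 q21 q25.
Qed.
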